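(* Let Problem 1 (the multi-commodity dynamic traffic assignment problem) and Problem 2 (its convex relaxation) be as defined in the context, with a cost function $\varphi(x,z)$ that is convex and differentiable in $(x,z)$, with $\frac{\partial}{\partial x}\varphi(x,z)\ge 0$, $\frac{\partial}{\partial z}\varphi(x,z)\le 0$ (entrywise) and $\varphi(0,0)=0$. For every feasible solution $(\bar x(t),\bar u(t))$ of Problem 2, with $\bar u=(\bar f,\mu)$, it is possible to set $\alpha(t)$ and $R(t)$ as $$\alpha_i^{(k)}(t)=\frac{\mu_i^{(k)}(t)+\sum_{j\in\mathcal E_k}\bar f_{ij}^{(k)}(t)}{d_i^{(k)}(\bar x_i^{(k)}(t))}\quad (i\in\mathcal E_k),\qquad R_{ij}^{(k)}(t)=\begin{cases}\dfrac{\bar f_{ij}^{(k)}(t)}{\sum_{l\in\mathcal E}\bar f_{il}^{(k)}(t)} & (i,j)\in\mathcal A_k\\ 0 & (i,j)\in(\mathcal E\times\mathcal E)\setminus\mathcal A_k\end{cases}$$ for all $k\in\mathcal K$, with the conventions that $\alpha_i^{(k)}=1$ if $\sum_{j}\bar f_{ij}^{(k)}=d_i^{(k)}(\bar x_i^{(k)})=0$, and that $R_{ij}^{(k)}=|\{l\in\mathcal E_k:(i,l)\in\mathcal A_k\}|^{-1}$ for $(i,j)\in\mathcal A_k$ if $\sum_{l}\bar f_{il}^{(k)}=0$. Then: (i) $(\alpha,R)$ is a (feasible) solution of Problem 1; (ii) $J(\alpha,R)\le\bar J(\bar x,\bar u)$.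
   Context: **Network.** $\mathcal G=(\mathcal V,\mathcal E)$ is a nonempty finite directed multigraph; edges are called cells. Each cell $i\in\mathcal E$ has tail $\sigma_i$ and head $\tau_i$ in $\mathcal V\cup\{w\}$, where $w$ is a virtual node representing the external world, and $\sigma_i\ne\tau_i$. On-ramps: $\mathcal O=\{i:\sigma_i=w\}$; off-ramps: $\mathcal S=\{i:\tau_i=w\}$. $\mathcal K$ is a nonempty finite set of commodities. Each $k\in\mathcal K$ has a set $\mathcal E_k\subseteq\mathcal E$ of utilizable cells; $\mathcal O_k=\mathcal O\cap\mathcal E_k$ and $\mathcal S_k=\mathcal S\cap\mathcal E_k$ are nonempty and every $i\in\mathcal E_k$ lies on a path (of utilizable cells) from some on-ramp in $\mathcal O_k$ to some off-ramp in $\mathcal S_k$. $\mathcal A_k=\{(i,j)\in\mathcal E_k\times\mathcal E_k:\tau_i=\sigma_j\ne w\}$. State space: $\mathcal X=\{x\in\mathbb R_+^{\mathcal E\times\mathcal K}: x_i^{(k)}=0\ \forall i\in\mathcal E\setminus\mathcal E_k\}$, with $x_i^{(k)}$ the volume of commodity $k$ on cell $i$. **Demand and supply.** Demand functions $d_i^{(k)}:\mathbb R_+\to\mathbb R_+$ ($k\in\mathcal K$, $i\in\mathcal E_k$) are continuously differentiable, concave, non-decreasing, with $d_i^{(k)}(0)=0$. Supply functions $s_i:\mathbb R_+\to\mathbb R_+$ are, for every $i\in\mathcal E\setminus\mathcal O$, continuously differentiable, concave and non-increasing. $w_i^{(k)}>0$ are given weights. **Inflows and controls.** Exogenous inflows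 $\lambda_i^{(k)}(t)\ge0$ for $i\in\mathcal O_k$, and $\lambda_i^{(k)}\equiv0$ for $i\in\mathcal E_k\setminus\mathcal O_k$. $\mathcal R^{(k)}$ is the set of matrices $M\in\mathbb R_+^{\mathcal E\times\mathcal E}$ with $\sum_{j\in\mathcal E}M_{ij}=1$ for $i\in\mathcal E_k\setminus\mathcal S_k$, $\sum_{j\in\mathcal E}M_{ij}=0$ for $i\in\mathcal S_k$, and $M_{ij}=0$ for $(i,j)\notin\mathcal A_k$. $\Omega=[0,1]^{\mathcal E\times\mathcal K}$. Controls are piecewise continuous functions $R^{(k)}:[0,T]\to\mathcal R^{(k)}$ ($k\in\mathcal K$) and $\alpha:[0,T]\to\Omega$; $R=(R^{(k)})_{k}$. Entries $\alpha_i^{(k)}$ with $i\notin\mathcal E_k$ play no role. **Dynamics.** For $k\in\mathcal K$, $i\in\mathcal E_k$: $\dot x_i^{(k)}=\lambda_i^{(k)}+\sum_{j\in\mathcal E_k}f_{ji}^{(k)}(x)-z_i^{(k)}(x)$, where $z_i^{(k)}=\sum_{j\in\mathcal E_k}f_{ij}^{(k)}$ if $i\in\mathcal E_k\setminus\mathcal S_k$, $z_i^{(k)}=\alpha_i^{(k)}d_i^{(k)}(x_i^{(k)})$ if $i\in\mathcal S_k$, and (FIFO rule) $f_{ij}^{(k)}=\gamma_i R_{ij}^{(k)}\alpha_i^{(k)}d_i^{(k)}(x_i^{(k)})$, with $\gamma_i=\gamma_i(x,\alpha,R)$ the largest $\tau\in[0,1]$ such that for every $j\in\mathcal E$ with $R_{ij}^{(k)}>0$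 for some $k\in\mathcal K$: $\tau\sum_{k\in\mathcal K}\sum_{h\in\mathcal E_k}R_{hj}^{(k)}\alpha_h^{(k)}d_h^{(k)}(x_h^{(k)})\le s_j\big(\sum_{k\in\mathcal K}w_j^{(k)}x_j^{(k)}\big)$. **Problem 1 (continuous-time MC-DTA).** Minimize $J(\alpha,R)=\int_0^T\varphi(x(t),z(t))\,dt$ over controls $\alpha(t)\in\Omega$, $R^{(k)}(t)\in\mathcal R^{(k)}$, subject to the dynamics above with given initial condition $x(0)=x^0\in\mathcal X$. **Problem 2 (relaxation).** Variables: $\bar x^{(k)}(t)\in\mathbb R_+^{\mathcal E_k}$, $\bar f^{(k)}(t)\in\mathbb R_+^{\mathcal A_k}$ (with $\bar f_{ij}^{(k)}=0$ for $(i,j)\notin\mathcal A_k$), $\mu^{(k)}(t)\in\mathbb R_+^{\mathcal E_k}$ with $\mu_i^{(k)}=0$ for $i\in\mathcal E_k\setminus\mathcal S_k$; $\bar u=(\bar f,\mu)$. Minimize $\bar J(\bar x,\bar u)=\int_0^T\varphi(\bar x,\bar u)\,dt$ subject to, for all $k\in\mathcal K$, $i\in\mathcal E_k$: $\dot{\bar x}_i^{(k)}=\lambda_i^{(k)}(t)+\sum_{j\in\mathcal E_k}\bar f_{ji}^{(k)}-\sum_{j\in\mathcal E_k}\bar f_{ij}^{(k)}-\mu_i^{(k)}$, $\bar x(0)=x^0$, the demand constraints $\mu_i^{(k)}+\sum_{j\in\mathcal E_k}\bar f_{ij}^{(k)}\le d_i^{(k)}(\bar x_i^{(k)})$ ($k\in\mathcal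 K,i\in\mathcal E_k$) and the supply constraints $\sum_{k\in\mathcal K}\sum_{j\in\mathcal E_k}\bar f_{ji}^{(k)}\le s_i\big(\sum_{k\in\mathcal K}w_i^{(k)}\bar x_i^{(k)}\big)$ ($i\in\mathcal E$), at all times $t\in[0,T]$. The notation $\varphi(\bar x,\bar u)$ means $\varphi(\bar x,\bar z)$ with $\bar z_i^{(k)}=\mu_i^{(k)}+\sum_{j\in\mathcal E_k}\bar f_{ij}^{(k)}$.
   Formalization: The prescribed controls need not be piecewise continuous (R can oscillate infinitely often where the outflow vanishes), so (i) is proved with measurable controls, and with piecewise continuous controls whenever the prescribed α and R are piecewise continuous; (ii) holds along the same trajectory. *)

(* Defs.v *)
From HB Require Import structures.
From mathcomp Require Import all_boot all_order all_algebra.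
From mathcomp Require Import all_classical all_reals all_analysis.
Import Order.TTheory GRing.Theory Num.Theory.
Import numFieldNormedType.Exports.

Set Implicit Arguments.
Unset Strict Implicit.
Unset Printing Implicit Defensive.

Local Open Scope classical_set_scope.
Local Open Scope ring_scope.

(* One-sided at 0: f is only meaningful on the half-line. *)
Definition C1_nonneg (R : realType) (f : R -> R) : Prop :=
  exists f' : R -> R,
    {within `[0, +oo[, continuous f'} /\
    forall v, 0 <= v ->
      (f u - f v) / (u - v) @[u --> within `[0, +oo[ v^'] --> f' v.

Definition concave_nonneg (R : realType) (f : R -> R) : Prop :=
  convex_function (`[0, +oo[%classic : set R) (fun v => - f v).

(* Cells are the elements of 'I_n.+1 and commodities those of 'I_m.+1, so that
   quantities indexed by them are matrices; both sets are thus nonempty.  The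
   virtual node w (the external world) is None. *)
Record network (V : finType) (n m : nat) := Network {
  tail : 'I_n.+1 -> option V;
  head : 'I_n.+1 -> option V;
  utilizable : 'I_m.+1 -> {set 'I_n.+1};
  tail_neq_head : forall i, tail i != head i;
  onramp := [set i | tail i == None]%SET;
  offramp := [set i | head i == None]%SET;
  adjacent := fun (k : 'I_m.+1) (i j : 'I_n.+1) =>
    [&& i \in utilizable k, j \in utilizable k, head i == tail j
      & tail j != None];
  onramp_nonempty : forall k, exists i, i \in onramp :&: utilizable k;
  offramp_nonempty : forall k, exists i, i \in offramp :&: utilizable k;
  utilizable_path : forall k i, i \in utilizable k ->
    exists o (p : seq 'I_n.+1),
      [/\ o \in onramp :&: utilizable k, path (adjacent k) o p,
          last o p \in offramp :&: utilizable k & i \in o :: p] }.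

(* x i k is the volume of commodity k on cell i. *)
Definition state_space (R : realType) (V : finType) (n m : nat)
    (N : network V n m) : set 'M[R]_(n.+1, m.+1) :=
  [set x | forall i k, 0 <= x i k /\ (i \notin utilizable N k -> x i k = 0)].
Arguments state_space R {V n m} N.

(* Supply functions exist off the on-ramps only, and demand functions on the
   utilizable cells only: the remaining entries of [supply] and [demand] are
   unconstrained and irrelevant. *)
Record model (R : realType) (V : finType) (n m : nat) (N : network V n m) :=
  Model {
  horizon : R;
  horizon_ge0 : 0 <= horizon;
  demand : 'I_n.+1 -> 'I_m.+1 -> R -> R;
  demand_ge0 : forall k i v,
    i \in utilizable N k -> 0 <= v -> 0 <= demand i k v;
  demand_C1 : forall k i, i \in utilizable N k -> C1_nonneg (demand i k);
  demand_concave : forall k i,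
    i \in utilizable N k -> concave_nonneg (demand i k);
  demand_nondecreasing : forall k i u v,
    i \in utilizable N k -> 0 <= u -> u <= v -> demand i k u <= demand i k v;
  demand_at0 : forall k i, i \in utilizable N k -> demand i k 0 = 0;
  supply : 'I_n.+1 -> R -> R;
  supply_ge0 : forall i v, i \notin onramp N -> 0 <= v -> 0 <= supply i v;
  supply_C1 : forall i, i \notin onramp N -> C1_nonneg (supply i);
  supply_concave : forall i, i \notin onramp N -> concave_nonneg (supply i);
  supply_nonincreasing : forall i u v,
    i \notin onramp N -> 0 <= u -> u <= v -> supply i v <= supply i u;
  weight : 'I_n.+1 -> 'I_m.+1 -> R;
  weight_gt0 : forall i k, 0 < weight i k;
  inflow : R -> 'I_n.+1 -> 'I_m.+1 -> R;
  inflow_ge0 : forall t i k, t \in `[0, horizon] ->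
    i \in onramp N :&: utilizable N k -> 0 <= inflow t i k;
  inflow_eq0 : forall t i k, t \in `[0, horizon] ->
    i \in utilizable N k :\: onramp N -> inflow t i k = 0 }.

Section Model.
Variables (R : realType) (V : finType) (n m : nat) (N : network V n m).
Variable P : model R N.

Local Notation T := (horizon P).
Local Notation cell := ('I_n.+1).
Local Notation commodity := ('I_m.+1).
Local Notation state := ('M[R]_(n.+1, m.+1)).
Local Notation routing := (commodity -> 'M[R]_n.+1).
Local Notation leb := (@lebesgue_measure R).

Definition cell_supply (x : state) (i : cell) : R :=
  supply P i (\sum_k weight P i k * x i k).

(* The set has a largest element as soon as x is a state and r consists of
   routing matrices, so that the supremum is this element. *)
Definition fifo_factor (x a : state) (r : routing) (i : cell) : R :=
  sup [set c : R | 0 <= c <= 1 /\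
    forall j, (exists k, 0 < r k i j) ->
      c * (\sum_k \sum_(h in utilizable N k)
             r k h j * a h k * demand P h k (x h k)) <= cell_supply x j].

Definition flow (x a : state) (r : routing) (k : commodity) (i j : cell) : R :=
  fifo_factor x a r i * r k i j * a i k * demand P i k (x i k).

Definition outflow (x a : state) (r : routing) : state :=
  \matrix_(i, k)
    if i \notin utilizable N k then 0
    else if i \in offramp N then a i k * demand P i k (x i k)
    else \sum_(j in utilizable N k) flow x a r k i j.

Definition routing_matrix (k : commodity) (M : 'M[R]_n.+1) : Prop :=
  [/\ forall i j, 0 <= M i j,
      forall i, i \in utilizable N k :\: offramp N -> \sum_j M i j = 1,
      forall i, i \in offramp N :&: utilizable N k -> \sum_j M i j = 0
    & forall i j, ~~ adjacent N k i j -> M i j = 0].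

(* dv/dt = g on [0, T] with v(0) = v0, in the sense of Caratheodory: v is
   absolutely continuous and the equation holds almost everywhere. *)
Definition ode_solution (g : R -> R) (v0 : R) (v : R -> R) : Prop :=
  leb.-integrable `[0, T] (EFin \o g) /\
  forall t, t \in `[0, T] -> v t = v0 + \int[leb]_(s in `[0, t]) g s.

Definition piecewise_continuous (f : R -> R) : Prop :=
  exists s : seq R,
    [/\ forall t, t \in `]0, T[ -> t \notin s -> {for t, continuous f},
        forall t, t \in `[0, T[ -> cvg (f @ t^'+)
      & forall t, t \in `]0, T] -> cvg (f @ t^'-)].

Definition measurable_on_horizon (f : R -> R) : Prop :=
  measurable_fun `[0, T] f.

Definition controls_in (C : (R -> R) -> Prop)
    (alpha : R -> state) (Rt : R -> routing) : Prop :=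
  (forall i k, C (fun t => alpha t i k)) /\
  (forall k i j, C (fun t => Rt t k i j)).

(* C is the regularity class in which the controls are sought: piecewise
   continuous, or merely measurable functions.  Both are needed, since a
   quotient such as f k i j / \sum_l f k i l may oscillate infinitely often
   where its denominator vanishes, even for continuous f. *)
Record problem1_feasible (C : (R -> R) -> Prop) (x0 : state)
    (x alpha : R -> state) (Rt : R -> routing) : Prop := Problem1Feasible {
  p1_class : controls_in C alpha Rt;
  p1_alpha : forall t i k, t \in `[0, T] -> 0 <= alpha t i k <= 1;
  p1_routing : forall t k, t \in `[0, T] -> routing_matrix k (Rt t k);
  p1_state : forall t, t \in `[0, T] -> state_space R N (x t);
  p1_dynamics : forall k i, i \in utilizable N k ->
    ode_solution
      (fun t => inflow P t i k
         + \sum_(j in utilizable N k) flow (x t) (alpha t) (Rt t) k j i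
         - outflow (x t) (alpha t) (Rt t) i k)
      (x0 i k) (fun t => x t i k) }.

Definition total_outflow (f : routing) (mu : state) : state :=
  \matrix_(i, k) (mu i k + \sum_(j in utilizable N k) f k i j).

(* Families indexed by E_k, A_k or S_k are extended by zero. *)
Record problem2_feasible (x0 : state)
    (x : R -> state) (f : R -> routing) (mu : R -> state) : Prop :=
  Problem2Feasible {
  p2_state : forall t, t \in `[0, T] -> state_space R N (x t);
  p2_flow_measurable : forall k i j,
    measurable_on_horizon (fun t => f t k i j);
  p2_exit_measurable : forall i k, measurable_on_horizon (fun t => mu t i k);
  p2_flow_ge0 : forall t k i j, t \in `[0, T] -> 0 <= f t k i j;
  p2_flow_eq0 : forall t k i j, t \in `[0, T] ->
    ~~ adjacent N k i j -> f t k i j = 0;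
  p2_exit_ge0 : forall t i k, t \in `[0, T] -> 0 <= mu t i k;
  p2_exit_eq0 : forall t i k, t \in `[0, T] ->
    i \notin offramp N :&: utilizable N k -> mu t i k = 0;
  p2_dynamics : forall k i, i \in utilizable N k ->
    ode_solution
      (fun t => inflow P t i k + \sum_(j in utilizable N k) f t k j i
         - \sum_(j in utilizable N k) f t k i j - mu t i k)
      (x0 i k) (fun t => x t i k);
  p2_demand : forall t k i, t \in `[0, T] -> i \in utilizable N k ->
    mu t i k + \sum_(j in utilizable N k) f t k i j
      <= demand P i k (x t i k);
  (* an on-ramp has no supply function, and no cell flows into it *)
  p2_supply : forall t i, t \in `[0, T] -> i \notin onramp N ->
    \sum_k \sum_(j in utilizable N k) f t k j i <= cell_supply (x t) i }.

(* The value 1 off the utilizable cells is arbitrary: these entries play no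
   role. *)
Definition demand_control (x : state) (f : routing) (mu : state) : state :=
  \matrix_(i, k)
    if i \notin utilizable N k then 1
    else if (\sum_(j in utilizable N k) f k i j == 0)
            && (demand P i k (x i k) == 0) then 1
    else (mu i k + \sum_(j in utilizable N k) f k i j) / demand P i k (x i k).

Definition routing_control (f : routing) : routing := fun k =>
  \matrix_(i, j)
    if ~~ adjacent N k i j then 0
    else if \sum_l f k i l == 0
    then (#|[set l in utilizable N k | adjacent N k i l]%SET|%:R)^-1
    else f k i j / \sum_l f k i l.

Definition cost (phi : state * state -> R) (x z : R -> state) : \bar R :=
  (\int[leb]_(t in `[0%R, T]) (phi (x t, z t))%:E)%E.

(* The arguments (x, z) at which the running cost is evaluated. *)
Definition cost_domain : set (state * state) :=
  [set p | state_space R N p.1 /\ state_space R N p.2].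

(* g is the gradient (dphi/dx, dphi/dz) at p of phi as a function on
   cost_domain, which need not contain a neighbourhood of p; its entries on
   non-utilizable cells are then arbitrary. *)
Definition cost_gradient (phi : state * state -> R) (p g : state * state) :
    Prop :=
  (phi q - phi p
     - \sum_i \sum_k (g.1 i k * (q.1 i k - p.1 i k)
                      + g.2 i k * (q.2 i k - p.2 i k))) / `|q - p|
    @[q --> within cost_domain p^'] --> (0 : R).

End Model.

Arguments cost_domain R {V n m} N.
Arguments cost_gradient {R V n m} N.

(* Main.v *)
Require Import Defs.
From HB Require Import structures.
From mathcomp Require Import all_boot all_order all_algebra.
From mathcomp Require Import all_classical all_reals all_analysis.
From mathcomp Require Import measurable_realfun.
Import Order.TTheory GRing.Theory Num.Theory.
Import numFieldNormedType.Exports.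
Local Open Scope classical_set_scope.
Local Open Scope ring_scope.

(** The state [xbar] of the relaxation is itself the state of the controlled
    network, so the two costs are equal.  At each time:

    - [alpha] scales the demand of a cell down to the total outflow
      [mu + \sum_j fbar] of the relaxation ([demand_controlK]); the demand
      constraint gives [alpha <= 1];
    - the routing matrix splits this outflow in the proportions of [fbar]
      ([routed_demandK]); its rows sum to 1 off the off-ramps because each such
      cell has a successor on its way to an off-ramp ([has_successor]);
    - the flows sent into a cell are thus those of [fbar], which fit its supply,
      and the FIFO rule throttles nothing ([fifo_factor_eq1]).

    Hence the flows and outflows of the controlled network are those of the
    relaxation ([flow_controlK], [outflow_controlK]), the differential equations
    coincide, and so do the running costs.

    What remains is the measurability of the controls in time.  They are
    quotients of measurable functions: the state is continuous, being a
    primitive, and the demand functions are monotone.  Piecewise continuity of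
    the controls is a hypothesis of the second claim, for which the same state
    serves. *)

Set Implicit Arguments.
Unset Strict Implicit.
Unset Printing Implicit Defensive.

Local Notation adjacent := Defs.adjacent.

(** * Adjacency in the network *)

Section Adjacency.
Context (V : finType) (n m : nat) (N : network V n m).

Lemma adjacent_utilizable k i j :
  adjacent N k i j -> (i \in utilizable N k) && (j \in utilizable N k).
Proof. by case/and4P => -> ->. Qed.

Lemma adjacent_notin_offramp k i j : adjacent N k i j -> i \notin offramp N.
Proof. by case/and4P => _ _ /eqP e tj; rewrite inE e. Qed.

Lemma adjacent_notin_onramp k i j : adjacent N k i j -> j \notin onramp N.
Proof. by case/and4P => _ _ _ tj; rewrite inE. Qed.

(** A route through [i] ends on an off-ramp, so it cannot stop at [i] if [i] is
    not an off-ramp itself: the next cell of the route is adjacent to [i]. *)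
Lemma has_successor k i :
  i \in utilizable N k -> i \notin offramp N -> exists j, adjacent N k i j.
Proof.
move=> ik iS; have [start [p [_ route offlast ip]]] := utilizable_path ik.
case/splitPl: p / ip route offlast => p1 [|j p2] lasti.
  by rewrite cats0 lasti inE (negPf iS).
by rewrite cat_path lasti /= => /and3P[_ ij _] _; exists j.
Qed.

Lemma sum_adjacent_utilizable (R : realType) k i (F : 'I_n.+1 -> R) :
  (forall j, ~~ adjacent N k i j -> F j = 0) ->
  \sum_j F j = \sum_(j in utilizable N k) F j.
Proof.
move=> F0; rewrite (bigID (mem (utilizable N k))) /= [X in _ + X]big1 ?addr0//.
by move=> j /negP jk; apply: F0; apply/negP => /adjacent_utilizable/andP[_].
Qed.

End Adjacency.

(** * The controls at a fixed time *)

Section ControlsAtFixedTime.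
Context (R : realType) (V : finType) (n m : nat) (N : network V n m).
Variables (P : model R N) (x mu : 'M[R]_(n.+1, m.+1)).
Variable f : 'I_m.+1 -> 'M[R]_n.+1.
Hypothesis f_ge0 : forall k i j, 0 <= f k i j.
Hypothesis f_eq0 : forall k i j, ~~ adjacent N k i j -> f k i j = 0.
Hypothesis mu_ge0 : forall i k, 0 <= mu i k.
Hypothesis mu_eq0 : forall i k,
  i \notin offramp N :&: utilizable N k -> mu i k = 0.
Hypothesis f_demand : forall k i, i \in utilizable N k ->
  mu i k + \sum_(j in utilizable N k) f k i j <= demand P i k (x i k).
Hypothesis f_supply : forall i, i \notin onramp N ->
  \sum_k \sum_(j in utilizable N k) f k j i <= cell_supply P x i.

Let a := demand_control P x f mu.
Let r := routing_control N f.

Let sum_f_ge0 k i : 0 <= \sum_(j in utilizable N k) f k i j.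
Proof. by apply: sumr_ge0 => j _; exact: f_ge0. Qed.

Lemma sum_flow_utilizable k i :
  \sum_j f k i j = \sum_(j in utilizable N k) f k i j.
Proof. exact/sum_adjacent_utilizable/f_eq0. Qed.

(** Where the demand vanishes, the demand constraint makes [mu] and the flows
    vanish too, so both sides are 0 whatever the value of [a]. *)
Lemma demand_controlK k i : i \in utilizable N k ->
  a i k * demand P i k (x i k) = mu i k + \sum_(j in utilizable N k) f k i j.
Proof.
move=> ik; rewrite mxE ik /=.
have [d0|d0] := eqVneq (demand P i k (x i k)) 0; last by rewrite andbF divfK.
have := f_demand ik; rewrite d0 mulr0 => le0.
by apply/eqP; rewrite eq_le le0 addr_ge0.
Qed.

Lemma demand_control_itv i k : 0 <= a i k <= 1.
Proof.
rewrite mxE; case: ifP => [_|/negbFE ik]; first by rewrite ler01 lexx.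
case: ifP => [_|]; first by rewrite ler01 lexx.
have le := f_demand ik.
have s0 := addr_ge0 (mu_ge0 i k) (sum_f_ge0 k i).
have [-> _|d0 _] := eqVneq (demand P i k (x i k)) 0.
  by rewrite invr0 mulr0 lexx ler01.
have dgt0 : 0 < demand P i k (x i k) by rewrite lt_def d0 (le_trans s0).
apply/andP; split; first by rewrite divr_ge0 // ltW.
by rewrite ler_pdivrMr // mul1r.
Qed.

Lemma routing_control_ge0 k i j : 0 <= r k i j.
Proof.
rewrite mxE; case: ifP => _; first exact: lexx.
case: ifP => _; first by rewrite invr_ge0 ler0n.
by rewrite divr_ge0 // sumr_ge0.
Qed.

Lemma routing_control_eq0 k i j : ~~ adjacent N k i j -> r k i j = 0.
Proof. by rewrite mxE => ->. Qed.

Lemma routing_control_matrix k : routing_matrix N k (r k).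
Proof.
split; [exact: routing_control_ge0| | |exact: routing_control_eq0].
- move=> i; rewrite inE => /andP[iS ik].
  have [f0|f0] := eqVneq (\sum_l f k i l) 0; last first.
    rewrite -[RHS](divff f0) mulr_suml; apply: eq_bigr => j _.
    by rewrite mxE (negPf f0); case: ifP => // /f_eq0 ->; rewrite mul0r.
  (* The equal shares add up to 1 because [i] has a successor. *)
  have [j0 ij0] := has_successor ik iS.
  set A := [set l in utilizable N k | adjacent N k i l]%SET.
  have AE j : (j \in A) = adjacent N k i j.
    rewrite inE; case: (boolP (adjacent N k i j)) => [/adjacent_utilizable|_].
      by case/andP=> _ ->.
    by rewrite andbF.
  rewrite (bigID (mem A)) /= [X in _ + X]big1 ?addr0; last first.
    by move=> j; rewrite AE => /routing_control_eq0.
  under eq_bigr => j.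
    rewrite AE => ij; rewrite mxE ij /= f0 eqxx; over.
  rewrite sumr_const -[_ *+ _]mulr_natr mulVf // pnatr_eq0 -lt0n.
  by apply/card_gt0P; exists j0; rewrite AE.
- move=> i; rewrite inE => /andP[iS _]; rewrite big1 // => j _.
  apply: routing_control_eq0; apply/negP => /adjacent_notin_offramp.
  by rewrite iS.
Qed.

(** A cell with a successor is not an off-ramp, so [mu] vanishes there: the
    outflow allowed by [a] is the total of the flows out of [i], and [r] splits
    it in the proportions of these flows. *)
Lemma routed_demandK k i j :
  r k i j * a i k * demand P i k (x i k) = f k i j.
Proof.
have [ij|nij] := boolP (adjacent N k i j); last first.
  by rewrite routing_control_eq0 // !mul0r f_eq0.
have /andP[ik _] := adjacent_utilizable ij.
rewrite -mulrA demand_controlK // mu_eq0 ?add0r; last first.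
  by rewrite inE (negPf (adjacent_notin_offramp ij)).
rewrite -sum_flow_utilizable mxE ij /=.
have [f0|f0] := eqVneq (\sum_l f k i l) 0; last by rewrite divfK.
rewrite f0 mulr0; apply/esym/eqP; move/eqP: f0.
by rewrite psumr_eq0 // => /allP/(_ j (mem_index_enum _))/implyP; apply.
Qed.

(** Before throttling, the flow that the controls send into a cell is the flow
    of the relaxation, which the supply constraint bounds; hence the factor 1 is
    admissible.  Only cells reached by a positive routing entry are concerned,
    and these are not on-ramps. *)
Lemma fifo_factor_eq1 i : fifo_factor P x a r i = 1.
Proof.
rewrite /fifo_factor; set A := [set c | _].
have A1 : A 1.
  split=> [|j [k]]; first by rewrite ler01 lexx.
  have [ij _|/routing_control_eq0 -> ] := boolP (adjacent N k i j); last first.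
    by rewrite ltxx.
  rewrite mul1r.
  under eq_bigr => l _ do under eq_bigr => h _ do rewrite routed_demandK.
  exact/f_supply/(adjacent_notin_onramp ij).
have ubA : ubound A 1 by move=> c [/andP[]].
apply/eqP; rewrite eq_le; apply/andP; split.
  by apply: ge_sup => //; exists 1.
by apply: ub_le_sup => //; exists 1.
Qed.

Lemma flow_controlK k i j : flow P x a r k i j = f k i j.
Proof. by rewrite /flow fifo_factor_eq1 mul1r routed_demandK. Qed.

Lemma outflow_controlK : outflow P x a r = total_outflow N f mu.
Proof.
apply/matrixP => i k; rewrite [LHS]mxE [RHS]mxE.
have [ik|nik] /= := boolP (i \in utilizable N k); last first.
  rewrite mu_eq0 ?inE ?(negPf nik) ?andbF // add0r big1 // => j _.
  by apply: f_eq0; rewrite /adjacent (negPf nik).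
have [iS|iS] := boolP (i \in offramp N).
  exact: demand_controlK.
rewrite mu_eq0 ?inE; last by move: iS; rewrite inE => /negPf ->.
by rewrite add0r; apply: eq_bigr => j _; exact: flow_controlK.
Qed.

End ControlsAtFixedTime.

(** * Measurability *)

Section Measurability.
Context (R : realType).

Lemma measurable_invr : measurable_fun [set: R] (@GRing.inv R).
Proof.
(* The inverse of 0 is 0, and inversion is continuous elsewhere. *)
rewrite (_ : @GRing.inv R = fun y => if y == 0 then 0 else y^-1); last first.
  by apply/funext => y; case: eqP => // ->; rewrite invr0.
have meq0 : measurable_fun [set: R] (fun y : R => y == 0).
  exact: measurable_fun_eqr.
apply: measurable_fun_if => //; rewrite setTI.
apply: open_continuous_measurable_fun.
  rewrite (_ : _ @^-1` _ = ~` [set 0]); last first.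
    by apply/seteqP; split=> y /=; [move=> /eqP|move=> /eqP/negPf].
  exact/closed_openC/closed_eq.
by move=> y; rewrite inE /= => /negbT y0; exact: inv_continuous.
Qed.

Lemma measurable_funV (D : set R) (g : R -> R) :
  measurable_fun D g -> measurable_fun D (fun t => (g t)^-1).
Proof. exact: measurableT_comp measurable_invr. Qed.

Lemma measurable_sum_in (I : finType) (A : {set I}) (D : set R)
    (g : I -> R -> R) : (forall i, measurable_fun D (g i)) ->
  measurable_fun D (fun t => \sum_(i in A) g i t).
Proof.
move=> mg; apply: (@eq_measurable_fun _ _ _ _ _
  (fun t => \sum_i (if i \in A then g i t else 0))).
  by move=> t _; rewrite [RHS]big_mkcond.
by apply: measurable_sum => i; case: (i \in A).
Qed.

(** Extending [g] by its value at 0 to the left of 0 makes it monotone on the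
    whole line. *)
Lemma measurable_nondecreasing_comp (D : set R) (g v : R -> R) :
  measurable D -> (forall y z, 0 <= y -> y <= z -> g y <= g z) ->
  (forall t, D t -> 0 <= v t) -> measurable_fun D v ->
  measurable_fun D (g \o v).
Proof.
move=> mD g_nd v_ge0 mv.
apply: (@eq_measurable_fun _ _ _ _ _ ((fun y => g (Num.max 0 y)) \o v)).
  by move=> t; rewrite inE => /v_ge0 vt; rewrite /= max_r.
apply: measurableT_comp mv; apply: nondecreasing_measurable => // y z yz.
apply: g_nd; first by rewrite le_max lexx.
by rewrite ge_max !le_max lexx yz orbT.
Qed.

End Measurability.

(** * Caratheodory solutions *)

Section CaratheodorySolutions.
Context (R : realType).

(** A Caratheodory solution is a primitive, hence continuous on the horizon. *)
Lemma ode_solution_measurable (V : finType) (n m : nat) (N : network V n m)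
    (P : model R N) (g v : R -> R) (v0 : R) :
  ode_solution P g v0 v -> measurable_on_horizon P v.
Proof.
case=> ig vE.
apply: (@eq_measurable_fun _ _ _ _ _
  (fun t => v0 + parameterized_integral lebesgue_measure 0 t g)).
  by move=> t; rewrite inE => /vE ->.
apply: measurable_funD => //.
apply: subspace_continuous_measurable_fun; first exact: measurable_itv.
exact: parameterized_integral_continuous (horizon_ge0 P) ig.
Qed.

Lemma ode_solution_eq (V : finType) (n m : nat) (N : network V n m)
    (P : model R N) (g h v : R -> R) (v0 : R) :
  {in `[0, horizon P], g =1 h} -> ode_solution P g v0 v ->
  ode_solution P h v0 v.
Proof.
move=> gh [ig vE]; split.
  apply: eq_integrable ig => //= t; rewrite inE /= => tT.
  by rewrite gh.
move=> t tT; rewrite vE //; congr (_ + _).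
apply: eq_Rintegral => s; rewrite inE /= => st; apply: gh.
move: tT st; rewrite !in_itv /= => /andP[_ tT] /andP[-> st].
exact: le_trans st tT.
Qed.

End CaratheodorySolutions.

(** * The controls along a trajectory of the relaxation *)

Section Trajectory.
Context (R : realType) (V : finType) (n m : nat) (N : network V n m).
Variables (P : model R N) (x0 : 'M[R]_(n.+1, m.+1)).
Variables (x mu : R -> 'M[R]_(n.+1, m.+1)) (f : R -> 'I_m.+1 -> 'M[R]_n.+1).
Hypothesis feasible : problem2_feasible P x0 x f mu.

Let alpha t := demand_control P (x t) (f t) (mu t).
Let Rt t := routing_control N (f t).

(** The demand is nondecreasing and the state is continuous in time. *)
Lemma demand_measurable i k : i \in utilizable N k ->
  measurable_on_horizon P (fun t => demand P i k (x t i k)).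
Proof.
move=> ik; apply: (@measurable_nondecreasing_comp _ _ _ (fun t => x t i k)).
- exact: measurable_itv.
- by move=> y z; exact: demand_nondecreasing.
- by move=> t tT; have [] := p2_state feasible tT i k.
- exact: ode_solution_measurable (p2_dynamics feasible ik).
Qed.

Lemma demand_control_measurable i k :
  measurable_on_horizon P (fun t => alpha t i k).
Proof.
under eq_fun => t do rewrite mxE.
case: (boolP (i \in utilizable N k)) => /= [ik|_];
  last exact: measurable_cst.
have md := demand_measurable ik.
have mf : measurable_on_horizon P
    (fun t => \sum_(j in utilizable N k) f t k i j).
  by apply: measurable_sum_in => j; exact: p2_flow_measurable feasible _ _ _.
have mmu := p2_exit_measurable feasible i k.
have mtest : measurable_fun `[0, horizon P] (fun t =>
    (\sum_(j in utilizable N k) f t k i j == 0) &&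
    (demand P i k (x t i k) == 0)).
  by apply: measurable_and; apply: measurable_fun_eqr.
apply: measurable_fun_if => //.
apply: measurable_funS (@subIsetl _ _ _) _; first exact: measurable_itv.
apply: measurable_funM; last exact: measurable_funV.
exact: measurable_funD.
Qed.

Lemma routing_control_measurable k i j :
  measurable_on_horizon P (fun t => Rt t k i j).
Proof.
under eq_fun => t do rewrite mxE.
case: (adjacent N k i j) => /=; last exact: measurable_cst.
have mf l : measurable_on_horizon P (fun t => f t k i l).
  exact: p2_flow_measurable feasible _ _ _.
have msum : measurable_on_horizon P (fun t => \sum_l f t k i l).
  exact: measurable_sum.
apply: measurable_fun_if => //; first exact: measurable_fun_eqr.
apply: measurable_funS (@subIsetl _ _ _) _; first exact: measurable_itv.
by apply: measurable_funM; [exact: mf|exact: measurable_funV].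
Qed.

Lemma relaxation_realized t : t \in `[0, horizon P] ->
  (forall k i j, flow P (x t) (alpha t) (Rt t) k i j = f t k i j) /\
  outflow P (x t) (alpha t) (Rt t) = total_outflow N (f t) (mu t).
Proof.
move=> tT; have f_ge0 k i j := p2_flow_ge0 feasible k i j tT.
have f_eq0 k i j := p2_flow_eq0 feasible (k:=k) (i:=i) (j:=j) tT.
have mu_ge0 i k := p2_exit_ge0 feasible i k tT.
have mu_eq0 i k := p2_exit_eq0 feasible (i:=i) (k:=k) tT.
have f_demand k i := p2_demand feasible (k:=k) (i:=i) tT.
have f_supply i := p2_supply feasible (i:=i) tT.
split=> [k i j|]; first exact: flow_controlK.
exact: outflow_controlK.
Qed.

(** The realized flows and outflows turn the right-hand side of the controlled
    dynamics into that of the relaxation, which [x] solves already. *)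
Lemma relaxation_problem1 (C : (R -> R) -> Prop) :
  controls_in C alpha Rt -> problem1_feasible P C x0 x alpha Rt.
Proof.
move=> inC; split => //.
- move=> t i k tT; apply: demand_control_itv.
  + by move=> *; exact: p2_flow_ge0 feasible _ _ _ _ tT.
  + by move=> *; exact: p2_exit_ge0 feasible _ _ _ tT.
  + by move=> *; exact: p2_demand feasible _ _ _ tT _.
- move=> t k tT; apply: routing_control_matrix.
  + by move=> *; exact: p2_flow_ge0 feasible _ _ _ _ tT.
  + by move=> *; exact: p2_flow_eq0 feasible _ _ _ _ tT _.
- exact: p2_state feasible.
- move=> k i ik; apply: ode_solution_eq (p2_dynamics feasible ik) => t tT /=.
  have [flowK outflowK] := relaxation_realized tT.
  rewrite outflowK mxE; under [in RHS]eq_bigr => j _ do rewrite flowK.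
  by rewrite opprD [- mu t i k - _]addrC !addrA.
Qed.

End Trajectory.

Theorem proposition3 (R : realType) (V : finType) (n m : nat)
    (N : network V n m) (P : model R N)
    (phi : 'M[R]_(n.+1, m.+1) * 'M[R]_(n.+1, m.+1) -> R)
    (phi_convex : convex_function (cost_domain R N) phi)
    (phi_differentiable : forall p, cost_domain R N p ->
      exists g, cost_gradient N phi p g)
    (phi_monotone : forall p g, cost_domain R N p -> cost_gradient N phi p g ->
      forall i k, i \in utilizable N k -> 0 <= g.1 i k /\ g.2 i k <= 0)
    (phi_at0 : phi (0, 0) = 0)
    (x0 : 'M[R]_(n.+1, m.+1)) (x0_state : state_space R N x0)
    (xbar : R -> 'M[R]_(n.+1, m.+1))
    (fbar : R -> 'I_m.+1 -> 'M[R]_n.+1)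
    (mu : R -> 'M[R]_(n.+1, m.+1))
    (feasible : problem2_feasible P x0 xbar fbar mu) :
  let alpha := fun t => demand_control P (xbar t) (fbar t) (mu t) in
  let Rt := fun t => routing_control N (fbar t) in
  exists x : R -> 'M[R]_(n.+1, m.+1),
    [/\ problem1_feasible P (measurable_on_horizon P) x0 x alpha Rt,
        controls_in (piecewise_continuous P) alpha Rt ->
          problem1_feasible P (piecewise_continuous P) x0 x alpha Rt
      & (cost P phi x (fun t => outflow P (x t) (alpha t) (Rt t))
           <= cost P phi xbar
                (fun t => total_outflow N (fbar t) (mu t)))%E].
Proof.
move=> alpha Rt; exists xbar; split.
- apply: relaxation_problem1 => //; split.
    exact: demand_control_measurable feasible.
  exact: routing_control_measurable feasible.
- exact: relaxation_problem1.
- rewrite le_eqVlt; apply/orP; left; apply/eqP/eq_integral => t.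
  by rewrite inE /= => tT; rewrite (relaxation_realized feasible tT).2.
Qed.
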